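(* Fix $t_0<0$ and $\alpha>0$. For $\epsilon\in(0,1)$ and $\Delta t>0$ let $t_m=t_0+m\Delta t$ for $m\in\mathbb{N}\cup\{0\}$, and let $\{x(m)\}$ be the solution of $$x(m+1)=-\frac{\Delta t}{\epsilon}x(m)^2+x(m)-\frac{\Delta t}{\epsilon}t_m\quad (m\in\mathbb{N}\cup\{0\}),\qquad x(0)=\sqrt{-t_0}+\alpha\epsilon .$$ (a) (Tipping at $m=1$) Let $\Delta t>1/\alpha$. Then $x(1)<-\sqrt{\max\{-t_1,0\}}$, that is, $x(1)$ is the tipping point. (b) (Tipping at $m=3$) Let $\Delta t=C\epsilon^b$ with $C>0$ and $b\in(0,1/2)$ (constants independent of $\epsilon$), and suppose that $\alpha>1/(-4t_0)$. Then there exists a small $\epsilon_0>0$ such that for every $\epsilon\in(0,\epsilon_0)$ the solution $\{x(m)\}$ satisfies: (i) $x(m)>0$ and $(-1)^m\big(x(m)-\sqrt{-t_m}\big)>0$ for $m=1,2$; and (ii) $x(3)<-\sqrt{-t_3}$.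
   Context: $\mathbb{N}=\{1,2,\dots\}$. Let $m_{\rm tip}:=\inf\{m\in\mathbb{N}: x(m)<-\sqrt{\max\{-t_m,0\}}\}$. The time $t_{m_{\rm tip}}$ is called the tipping time and the value $x(m_{\rm tip})$ the tipping point of the solution $\{x(m)\}$. *)

(* Defs.v *)
From Stdlib Require Import Reals.
From Coquelicot Require Import Coquelicot.
Open Scope R_scope.

Definition tm (t0 dt : R) (m : nat) : R := t0 + INR m * dt.

Fixpoint xsol (t0 alpha eps dt : R) (m : nat) : R :=
  match m with
  | O => sqrt (- t0) + alpha * eps
  | S k =>
      let y := xsol t0 alpha eps dt k in
      - (dt / eps) * y ^ 2 + y - dt / eps * tm t0 dt k
  end.

(* [m_tip], an infimum over m >= 1 with values in the extended reals:
   [p_infty] when the solution never tips. *)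
Definition mtip (t0 alpha eps dt : R) : Rbar :=
  Glb_Rbar (fun r => exists m : nat,
    (1 <= m)%nat /\ r = INR m /\
    xsol t0 alpha eps dt m < - sqrt (Rmax (- tm t0 dt m) 0)).

(* The term x(m) of the solution is its tipping point x(m_tip).  The index is
   compared, not the value, since a value may occur at several indices. *)
Definition tipping_point_at (t0 alpha eps dt : R) (m : nat) : Prop :=
  mtip t0 alpha eps dt = Finite (INR m).

(* Main.v *)
(** Write [s = sqrt (- t0)].  The first iterate is
    [x(1) = s - 2 s alpha dt + alpha eps - alpha^2 eps dt].  If [alpha dt > 1]
    this is already below [- s], which gives (a).

    For (b), [sqrt (- t_1) = s - dt / (2 s) + O(dt^2)], so [alpha > 1 / (4 s^2)]
    puts [x(1)] below the root by at least [c dt / 2] with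
    [c = 2 s alpha - 1 / (2 s) > 0].  The next step overshoots: [x(2)] is at
    least of order [dt^2 / eps], which diverges because [b < 1/2].  As
    [dt / eps] diverges too, the quadratic term then dominates and sends [x(3)]
    far below [- s]. *)

Require Import Defs.
From Stdlib Require Import Reals Lra Lia.
From Coquelicot Require Import Coquelicot.
Open Scope R_scope.

Lemma sqrt_Rmax_le (x s : R) : 0 <= s -> x <= s * s -> sqrt (Rmax x 0) <= s.
Proof.
  intros hs hx.
  rewrite <- (sqrt_square s hs).
  apply sqrt_le_1_alt, Rmax_lub; nra.
Qed.

(** With [u = h / s^2] the left side is [s (1 - u)(1 + u/2)]. Squaring reduces the bound to
    [(1 - u)(1 + u/2)^2 <= 1], where the left side is [1 - 3u^2/4 - u^3/4]. *)
Lemma sqrt_taylor2_lower (s h : R) : 0 < s -> 0 <= h <= s * s ->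
  s - h / (2 * s) - h ^ 2 / (2 * s ^ 3) <= sqrt (s * s - h).
Proof.
  intros hs [h0 h1].
  set (u := h / (s * s)).
  assert (hu : h = u * (s * s)) by (unfold u; field; lra).
  assert (u0 : 0 <= u) by (unfold u; apply Rdiv_le_0_compat; nra).
  assert (u1 : u <= 1) by (apply Rmult_le_reg_r with (s * s); nra).
  clearbody u; subst h.
  replace (u * (s * s) / (2 * s)) with (s * (u / 2)) by (field; lra).
  replace ((u * (s * s)) ^ 2 / (2 * s ^ 3)) with (s * (u ^ 2 / 2)) by (field; lra).
  replace (s * s - u * (s * s)) with ((s * s) * (1 - u)) by ring.
  rewrite sqrt_mult_alt, sqrt_square by nra.
  assert (1 - u / 2 - u ^ 2 / 2 <= sqrt (1 - u)).
  { replace (1 - u / 2 - u ^ 2 / 2) with ((1 - u) * (1 + u / 2)) by field.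
    rewrite <- (sqrt_square ((1 - u) * (1 + u / 2))) by nra.
    apply sqrt_le_1_alt.
    assert ((1 - u) * ((1 + u / 2) * (1 + u / 2)) <= 1) by nra.
    nra. }
  nra.
Qed.

Lemma Rpower_eventually_lt (p M : R) : 0 < p -> 0 < M ->
  exists d, 0 < d < 1 /\ forall e, 0 < e < d -> Rpower e p < M.
Proof.
  intros hp hM.
  exists (Rmin (1 / 2) (Rpower M (/ p))).
  assert (0 < Rpower M (/ p)) by apply exp_pos.
  pose proof (Rmin_l (1 / 2) (Rpower M (/ p))).
  pose proof (Rmin_r (1 / 2) (Rpower M (/ p))).
  split.
  - split; [apply Rmin_pos; lra | lra].
  - intros e he.
    apply Rlt_le_trans with (Rpower (Rpower M (/ p)) p).
    + apply Rlt_Rpower_l; lra.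
    + rewrite Rpower_mult, Rinv_l, Rpower_1 by lra; lra.
Qed.

(** The tipping threshold is never positive, so a positive iterate cannot have tipped; the infimum
    is then attained at [m]. *)
Lemma tipping_point_at_first (t0 alpha eps dt : R) (m : nat) :
  (1 <= m)%nat ->
  xsol t0 alpha eps dt m < - sqrt (Rmax (- tm t0 dt m) 0) ->
  (forall k, (1 <= k < m)%nat -> 0 < xsol t0 alpha eps dt k) ->
  tipping_point_at t0 alpha eps dt m.
Proof.
  intros hm htip hpos.
  apply is_glb_Rbar_unique; split.
  - intros r (k & hk & -> & hx).
    apply le_INR.
    destruct (Nat.le_gt_cases m k) as [|hlt]; [assumption|].
    assert (0 < xsol t0 alpha eps dt k) by (apply hpos; lia).
    pose proof (sqrt_pos (Rmax (- tm t0 dt k) 0)); lra.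
  - intros l hl; apply hl; exists m; auto.
Qed.

Lemma xsol_1 (t0 alpha eps dt : R) : t0 < 0 -> eps <> 0 ->
  xsol t0 alpha eps dt 1 =
  sqrt (- t0) - 2 * sqrt (- t0) * alpha * dt + alpha * eps - alpha ^ 2 * eps * dt.
Proof.
  intros ht he; simpl; unfold tm; simpl.
  assert (hs : t0 = - (sqrt (- t0) * sqrt (- t0))) by (rewrite sqrt_sqrt; lra).
  set (s := sqrt (- t0)) in *; clearbody s; subst t0.
  field; assumption.
Qed.

Lemma tipping_at_1 (t0 alpha eps dt : R) :
  t0 < 0 -> 0 < alpha -> 0 < eps -> dt > 1 / alpha ->
  xsol t0 alpha eps dt 1 < - sqrt (Rmax (- tm t0 dt 1) 0).
Proof.
  intros ht ha he hdt.
  rewrite xsol_1 by lra.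
  assert (hs : 0 < sqrt (- t0)) by (apply sqrt_lt_R0; lra).
  assert (hss : sqrt (- t0) * sqrt (- t0) = - t0) by (apply sqrt_sqrt; lra).
  assert (hadt : 1 < alpha * dt).
  { replace 1 with (alpha * (1 / alpha)) by (field; lra).
    apply Rmult_lt_compat_l; lra. }
  assert (hroot : sqrt (Rmax (- tm t0 dt 1) 0) <= sqrt (- t0)).
  { apply sqrt_Rmax_le; [lra|]. unfold tm; simpl; nra. }
  (* Since [x(1) + s = (2 s + alpha eps)(1 - alpha dt)] with [s = sqrt (- t0)], the sign is that of
     [1 - alpha dt]. *)
  assert (0 < alpha * eps) by nra.
  assert (sqrt (- t0) < sqrt (- t0) * (alpha * dt)) by nra.
  assert (alpha * eps < (alpha * eps) * (alpha * dt)) by nra.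
  nra.
Qed.

(* Inequalities on [h] and [e] that hold for [h = C e^b] with [b < 1/2] and [e]
   small; [c] is the first-order gap below the root at [m = 1]. *)
Lemma three_step_tipping (s alpha e h x1 x2 x3 r1 r2 : R) :
  let c := 2 * s * alpha - 1 / (2 * s) in
  0 < s -> 0 < alpha -> 0 < e < 1 -> 0 < h -> 0 < c ->
  3 * h <= s * s ->
  h * (2 * s * alpha + alpha ^ 2) < s ->
  h / (2 * s ^ 3) <= c / 4 ->
  alpha * e <= h * (c / 4) ->
  8 * e <= h ^ 2 * c ->
  2 * e <= h * s ->
  x1 = s - 2 * s * alpha * h + alpha * e - alpha ^ 2 * e * h ->
  r1 = sqrt (s * s - h) ->
  r2 = sqrt (s * s - 2 * h) ->
  x2 = x1 - h / e * (x1 ^ 2 - (s * s - h)) ->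
  x3 = x2 - h / e * (x2 ^ 2 - (s * s - 2 * h)) ->
  0 < x1 < r1 /\ r2 < x2 /\ x3 < - s.
Proof.
  intros c hs ha he hh hc h3 hx hgap hae h2 h1 X1 R1 R2 X2 X3.
  assert (hT := sqrt_taylor2_lower s h hs ltac:(lra)).
  rewrite <- R1 in hT.
  assert (r1sq : r1 * r1 = s * s - h) by (rewrite R1; apply sqrt_sqrt; lra).
  assert (r1pos : 0 <= r1) by (rewrite R1; apply sqrt_pos).
  assert (r1half : s / 2 <= r1) by nra.
  assert (r2sq : r2 * r2 = s * s - 2 * h) by (rewrite R2; apply sqrt_sqrt; lra).
  assert (r2pos : 0 <= r2) by (rewrite R2; apply sqrt_pos).
  assert (r2le : r2 <= s) by nra.
  assert (x1pos : 0 < x1).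
  { assert (0 < alpha * e) by nra.
    assert (0 < alpha ^ 2 * h) by nra.
    assert (alpha ^ 2 * e * h <= alpha ^ 2 * h) by nra.
    nra. }
  (* To first order [r1 - x1] is [h c]; the Taylor remainder and [alpha * e] each cost at most
     [h c / 4]. *)
  assert (gap : h * (c / 2) <= r1 - x1).
  { assert (h ^ 2 / (2 * s ^ 3) <= h * (c / 4)).
    { replace (h ^ 2 / (2 * s ^ 3)) with (h * (h / (2 * s ^ 3))) by (field; lra).
      apply Rmult_le_compat_l; lra. }
    assert (0 < alpha ^ 2 * e * h)
      by (pose proof (pow_lt alpha 2 ha); repeat apply Rmult_lt_0_compat; lra).
    assert (h / (2 * s) = h * (2 * s * alpha) - h * c) by (unfold c; field; lra).
    nra. }
  assert (hc' : 0 < h * (c / 2)) by nra.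
  assert (k0 : 0 < h / e) by (apply Rdiv_lt_0_compat; lra).
  assert (ks : 2 <= h / e * s).
  { apply Rmult_le_reg_r with e; [lra|].
    replace (h / e * s * e) with (h * s) by (field; lra); lra. }
  assert (khc : 8 <= h / e * (h * c)).
  { apply Rmult_le_reg_r with e; [lra|].
    replace (h / e * (h * c) * e) with (h ^ 2 * c) by (field; lra); lra. }
  (* Here [x2 = x1 + h/e (r1 - x1)(r1 + x1)], with factors at least [h c / 2] and [s / 2]; [khc]
     makes the increment at least [8 s / 4]. *)
  assert (x2big : 2 * s <= x2).
  { replace (s * s - h) with (r1 * r1) in X2.
    assert (h * (c / 2) * (s / 2) <= (r1 - x1) * (r1 + x1))
      by (apply Rmult_le_compat; nra).
    assert (h / e * (h * (c / 2) * (s / 2)) <= h / e * ((r1 - x1) * (r1 + x1)))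
      by (apply Rmult_le_compat_l; lra).
    nra. }
  split; [lra | split; [lra|]].
  rewrite <- r2sq in X3.
  (* From [r2 <= s] and [2 s <= x2]. Multiplied by [h / e], with [ks], it makes the decrement at
     least [3 x2], so [x3 <= - 2 x2 <= - 4 s]. *)
  assert (3 / 2 * s * x2 <= x2 ^ 2 - r2 * r2) by nra.
  assert (h / e * (3 / 2 * s * x2) <= h / e * (x2 ^ 2 - r2 * r2))
    by (apply Rmult_le_compat_l; lra).
  assert (2 * x2 <= h / e * s * x2) by (apply Rmult_le_compat_r; lra).
  nra.
Qed.

(** Write [e = e^(1 - 2b) (e^b)^2]: as [b < 1/2], the first factor tends to 0 and falls below
    [K C^2]. *)
Lemma eventually_small_step (C b H K : R) :
  0 < C -> 0 < b < 1 / 2 -> 0 < H -> 0 < K ->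
  exists e0, 0 < e0 < 1 /\ forall e, 0 < e < e0 ->
    0 < C * Rpower e b < H /\ e <= K * (C * Rpower e b) ^ 2.
Proof.
  intros hC hb hH hK.
  destruct (Rpower_eventually_lt b (H / C)) as (d1 & hd1 & P1);
    [lra | apply Rdiv_lt_0_compat; lra |].
  assert (0 < K * C ^ 2) by (apply Rmult_lt_0_compat; [|apply pow_lt]; lra).
  destruct (Rpower_eventually_lt (1 - 2 * b) (K * C ^ 2)) as (d2 & hd2 & P2);
    [lra | lra |].
  exists (Rmin d1 d2).
  pose proof (Rmin_l d1 d2); pose proof (Rmin_r d1 d2).
  split; [split; [apply Rmin_pos; lra | lra] |].
  intros e he.
  specialize (P1 e ltac:(lra)); specialize (P2 e ltac:(lra)).
  assert (hp : 0 < Rpower e b) by apply exp_pos.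
  split.
  - split; [nra|].
    replace H with (C * (H / C)) by (field; lra).
    apply Rmult_lt_compat_l; lra.
  - assert (E : e = Rpower e (1 - 2 * b) * (Rpower e b) ^ 2).
    { replace ((Rpower e b) ^ 2) with (Rpower e b * Rpower e b) by ring.
      rewrite <- !Rpower_plus.
      replace (1 - 2 * b + (b + b)) with 1 by ring.
      rewrite Rpower_1; lra. }
    rewrite E at 1.
    replace (K * (C * Rpower e b) ^ 2) with (K * C ^ 2 * Rpower e b ^ 2) by ring.
    apply Rmult_le_compat_r; nra.
Qed.

Lemma xsol_S (t0 alpha eps dt : R) (k : nat) :
  xsol t0 alpha eps dt (S k) =
  xsol t0 alpha eps dt k -
    dt / eps * (xsol t0 alpha eps dt k ^ 2 - - tm t0 dt k).
Proof. simpl; ring. Qed.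

Theorem theorem2 (t0 alpha : R) (ht0 : t0 < 0) (halpha : 0 < alpha) :
  (forall eps dt : R, 0 < eps < 1 -> dt > 1 / alpha ->
     xsol t0 alpha eps dt 1 < - sqrt (Rmax (- tm t0 dt 1) 0) /\
     tipping_point_at t0 alpha eps dt 1)
  /\
  (forall C b : R, 0 < C -> 0 < b < 1 / 2 -> alpha > 1 / (- 4 * t0) ->
     exists eps0 : R, 0 < eps0 < 1 /\
       forall eps : R, 0 < eps < eps0 ->
         let dt := C * Rpower eps b in
         (forall m : nat, m = 1%nat \/ m = 2%nat ->
            xsol t0 alpha eps dt m > 0 /\
            (-1) ^ m * (xsol t0 alpha eps dt m - sqrt (- tm t0 dt m)) > 0) /\
         (tm t0 dt 3 <= 0 /\
          xsol t0 alpha eps dt 3 < - sqrt (- tm t0 dt 3)) /\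
         tipping_point_at t0 alpha eps dt 3).
Proof.
  split.
  { intros eps dt he hdt.
    assert (hx := tipping_at_1 t0 alpha eps dt ht0 halpha (proj1 he) hdt).
    split; [exact hx|].
    apply tipping_point_at_first; [lia | exact hx | intros; lia]. }
  intros C b hC hb ha.
  set (s := sqrt (- t0)).
  assert (hs : 0 < s) by (apply sqrt_lt_R0; lra).
  assert (hss : s * s = - t0) by (apply sqrt_sqrt; lra).
  set (c := 2 * s * alpha - 1 / (2 * s)).
  assert (hc : 0 < c).
  { replace c with (2 * s * (alpha - 1 / (- 4 * t0)))
      by (unfold c; replace t0 with (- (s * s)) by lra; field; lra).
    apply Rmult_lt_0_compat; lra. }
  assert (hA : 0 < 2 * s * alpha + alpha ^ 2) by nra.
  assert (hs3 : 0 < 2 * s ^ 3) by (pose proof (pow_lt s 3 hs); lra).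
  (* Upper bounds on [dt], one for each smallness condition on [h] alone; the entry 1 serves to pass
     from [eps <= K dt^2] to [eps <= K dt]. *)
  set (H := Rmin (Rmin (s * s / 3) (s / (2 * s * alpha + alpha ^ 2)))
                 (Rmin (c / 4 * (2 * s ^ 3)) 1)).
  (* The entries give, in order, the bounds on [alpha * e], [8 * e] and [2 * e]. *)
  set (K := Rmin (c / 4 / alpha) (Rmin (c / 8) (s / 2))).
  assert (hH : 0 < H).
  { unfold H; repeat apply Rmin_pos; try (apply Rdiv_lt_0_compat); nra. }
  assert (hK : 0 < K).
  { unfold K; repeat apply Rmin_pos; repeat (apply Rdiv_lt_0_compat); lra. }
  destruct (eventually_small_step C b H K hC hb hH hK) as (e0 & he0 & P).
  exists e0; split; [exact he0|].
  intros eps he dt.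
  destruct (P eps he) as [[h0 hlt] hK2]; fold dt in h0, hlt, hK2.
  clearbody dt; clear P.
  assert (hlt1 : dt < s * s / 3 /\ dt < s / (2 * s * alpha + alpha ^ 2) /\
                 dt < c / 4 * (2 * s ^ 3) /\ dt < 1).
  { unfold H in hlt.
    apply Rmin_Rgt in hlt as [[? ?]%Rmin_Rgt [? ?]%Rmin_Rgt]; lra. }
  destruct hlt1 as (L1 & L2 & L3 & L4).
  assert (K1 : K <= c / 4 / alpha) by apply Rmin_l.
  assert (K23 : K <= Rmin (c / 8) (s / 2)) by apply Rmin_r.
  pose proof (Rmin_l (c / 8) (s / 2)); pose proof (Rmin_r (c / 8) (s / 2)).
  assert (hKh : eps <= K * dt) by nra.
  assert (step := three_step_tipping s alpha eps dt
    (xsol t0 alpha eps dt 1) (xsol t0 alpha eps dt 2) (xsol t0 alpha eps dt 3)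
    (sqrt (- tm t0 dt 1)) (sqrt (- tm t0 dt 2))).
  cbv zeta in step; fold c in step.
  assert (T1 : - tm t0 dt 1 = s * s - dt) by (unfold tm; simpl; lra).
  assert (T2 : - tm t0 dt 2 = s * s - 2 * dt) by (unfold tm; simpl; lra).
  assert (T3 : - tm t0 dt 3 = s * s - 3 * dt) by (unfold tm; simpl; lra).
  destruct step as ([x1pos x1lt] & x2gt & x3lt); try lra.
  - apply Rmult_lt_compat_r with (r := 2 * s * alpha + alpha ^ 2) in L2; [|lra].
    replace (s / (2 * s * alpha + alpha ^ 2) * (2 * s * alpha + alpha ^ 2))
      with s in L2 by (field; nra).
    lra.
  - apply Rle_div_l; lra.
  - apply Rle_trans with (alpha * (K * dt)); [apply Rmult_le_compat_l; lra|].
    replace (dt * (c / 4)) with (alpha * (c / 4 / alpha * dt)) by (field; lra).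
    apply Rmult_le_compat_l; [lra|]. apply Rmult_le_compat_r; lra.
  - assert (K * dt ^ 2 <= c / 8 * dt ^ 2) by (apply Rmult_le_compat_r; nra); lra.
  - assert (K * dt <= s / 2 * dt) by (apply Rmult_le_compat_r; lra); lra.
  - apply xsol_1; lra.
  - now rewrite T1.
  - now rewrite T2.
  - rewrite <- T1; apply xsol_S.
  - rewrite <- T2; apply xsol_S.
  - pose proof (sqrt_pos (- tm t0 dt 2)) as r2pos.
    assert (root3 : sqrt (Rmax (- tm t0 dt 3) 0) <= s)
      by (apply sqrt_Rmax_le; lra).
    (* This ensures that the root in (ii) is genuine, not the default value 0 of [sqrt] at negative
       arguments. *)
    assert (t3 : tm t0 dt 3 <= 0) by lra.
    split; [|split; [split; [exact t3|]|]].
    + intros m [-> | ->]; split; lra.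
    + rewrite Rmax_left in root3 by lra; lra.
    + apply tipping_point_at_first; [lia | lra |].
      intros k hk.
      assert (k = 1%nat \/ k = 2%nat) as [-> | ->] by lia; lra.
Qed.
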